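(* Let $\mathcal I=((H_n)_{n\in\mathbb N_0},a^* )$ be an interacting Fock space based on a pre-Hilbert space $H$, with associated map $\Lambda\colon\mathscr F(H)\to\mathcal I$. The following are equivalent: 1. $\Lambda$ has an adjoint $\Lambda^*\in\mathscr L(\mathcal I,\overline{\mathscr F(H)})$, i.e. $\langle\Lambda X,Y\rangle=\langle X,\Lambda^*Y\rangle$ for all $X\in\mathscr F(H)$, $Y\in\mathcal I$. 2. The corresponding ALV-interacting Fock space is POI, i.e. there is a linear map $L=\bigoplus_{n\in\mathbb N_0}L_n\colon\mathscr F(H)\to\overline{\mathscr F(H)}$ with $L_n\colon H^{\otimes n}\to\overline{H^{\otimes n}}$ and $L\Omega=\Omega$, such that the semiinner product $(\bullet,\bullet):=\langle\Lambda\bullet,\Lambda\bullet\rangle$ on $\mathscr F(H)$ satisfies $(X,Y)=\langle X,LY\rangle$ for all $X,Y\in\mathscr F(H)$.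
   Context: All vector spaces are complex; direct sums and tensor products of pre-Hilbert spaces are algebraic; $\overline V$ is the completion of a pre-Hilbert space $V$; $\mathscr L(V,W)$ is the space of all linear maps $V\to W$. $\mathscr F(H)=\Omega\mathbb C\oplus\bigoplus_{n\ge1}H^{\otimes n}$ is the algebraic full Fock space over $H$ with its natural inner product $\langle\bullet,\bullet\rangle$ ($\Omega$ a unit vector). An interacting Fock space based on a pre-Hilbert space $H$ consists of pre-Hilbert spaces $H_n$ ($n\in\mathbb N_0$) with $H_0=\Omega\mathbb C$, $\Omega$ a unit vector, the space $\mathcal I=\bigoplus_{n}H_n$, and a linear map $a^*\colon H\to\mathscr L(\mathcal I)$ with $\operatorname{span}a^*(H)H_n=H_{n+1}$ for all $n$. Its associated surjective linear map $\Lambda\colon\mathscr F(H)\to\mathcal I$ is given by $\Lambda\Omega=\Omega$, $\Lambda(x_n\otimes\dots\otimes x_1)=a^*(x_n)\cdots a^*(x_1)\Omega$. An ALV-interacting Fock space is a quotient $\mathscr F(H)/\mathscr N$, where $\mathscr F(H)$ carries a semiinner product $(\bullet,\bullet)=\bigoplus_n(\bullet,\bullet)_n$ (direct sum of semiinner products on the $H^{\otimes n}$, $(\Omega,\Omega)=1$) with kernel $\mathscr N$ satisfying $H\otimes\mathscr N\subset\mathscr N$; creation operators are $X+\mathscr N\mapsto x\otimes X+\mathscr N$. The ALV-interacting Fock space corresponding to $\mathcal I$ is the one given by $(\bullet,\bullet)=\langle\Lambda\bullet,\Lambda\bullet\rangle$. It is called POI (positive operator induced) if $(\bullet,\bullet)=\langle\bullet,L\bullet\rangle$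 for some $L$ as described in item 2. *)

(* Defs.v *)
From HB Require Import structures.
From mathcomp Require Import all_boot all_order all_algebra sesquilinear complex.
From mathcomp Require Import all_classical all_reals all_analysis.

Set Implicit Arguments.
Unset Strict Implicit.
Unset Printing Implicit Defensive.

Import Order.TTheory GRing.Theory Num.Theory.
Import numFieldNormedType.Exports.
Local Open Scope quotient_scope.
Local Open Scope classical_set_scope.
Local Open Scope ring_scope.

Definition submodule (K : nzRingType) (V : lmodType K) (S : set V) : Prop :=
  S 0 /\ forall (a : K) (u v : V), S u -> S v -> S (a *: u + v).

Definition lspan (K : nzRingType) (V : lmodType K) (A : set V) : set V :=
  smallest (@submodule K V) A.

Section Bundles.
Variables (K : nzRingType) (U V W : lmodType K).

Definition mk_linear (f : U -> V) (fP : linear f) : {linear U -> V} :=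
  HB.pack f (GRing.isLinear.Build K U V *:%R f fP).

Definition mk_bilinear (f : U -> V -> W) (fP : bilinear_for *:%R *:%R f) :
    {bilinear U -> V -> W} :=
  HB.pack f (bilinear_isBilinear.Build K U V W *:%R *:%R f fP).

End Bundles.

Record dsum (K : nzRingType) (I : choiceType) (V : I -> lmodType K) := Dsum {
  dsfun :> forall i, V i;
  dsfunP : finite_set [set i | dsfun i != 0] }.

Section DirectSum.
Variables (K : nzRingType) (I : choiceType) (V : I -> lmodType K).
Implicit Types u v w : dsum V.

Lemma dsumP u v : (forall i, u i = v i) -> u = v.
Proof.
case: u v => [f fP] [g gP] /= fg.
have {}fg : f = g by apply: functional_extensionality_dep.
by case: g / fg gP => gP; rewrite (Prop_irrelevance fP gP).
Qed.

HB.instance Definition _ := gen_eqMixin (dsum V).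
HB.instance Definition _ := gen_choiceMixin (dsum V).

Lemma ds0P : finite_set [set i | (0 : V i) != 0].
Proof.
rewrite (_ : [set _ | _] = set0) ?finite_set0 //.
by apply/seteqP; split => i //=; rewrite eqxx.
Qed.
Definition ds0 := Dsum ds0P.

Lemma dsoppP u : finite_set [set i | - u i != 0].
Proof. by apply: sub_finite_set (dsfunP u) => i /=; rewrite oppr_eq0. Qed.
Definition dsopp u := Dsum (dsoppP u).

Lemma dsaddP u v : finite_set [set i | u i + v i != 0].
Proof.
have : finite_set ([set i | u i != 0] `|` [set i | v i != 0]).
  by rewrite finite_setU; split; apply: dsfunP.
apply: sub_finite_set => i /=.
by have [->|] := eqVneq (u i) 0; [rewrite add0r; right | left].
Qed.
Definition dsadd u v := Dsum (dsaddP u v).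

Lemma dsscaleP (a : K) u : finite_set [set i | a *: u i != 0].
Proof.
apply: sub_finite_set (dsfunP u) => i /=.
by apply: contra_neq => ->; rewrite scaler0.
Qed.
Definition dsscale a u := Dsum (dsscaleP a u).

Fact dsaddA : associative dsadd.
Proof. by move=> u v w; apply: dsumP => i /=; rewrite addrA. Qed.
Fact dsaddC : commutative dsadd.
Proof. by move=> u v; apply: dsumP => i /=; rewrite addrC. Qed.
Fact dsadd0 : left_id ds0 dsadd.
Proof. by move=> u; apply: dsumP => i /=; rewrite add0r. Qed.
Fact dsaddN : left_inverse ds0 dsopp dsadd.
Proof. by move=> u; apply: dsumP => i /=; rewrite addNr. Qed.
HB.instance Definition _ :=
  GRing.isZmodule.Build (dsum V) dsaddA dsaddC dsadd0 dsaddN.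

Fact dsscaleA a b u : dsscale a (dsscale b u) = dsscale (a * b) u.
Proof. by apply: dsumP => i /=; rewrite scalerA. Qed.
Fact dsscale1 : left_id 1 dsscale.
Proof. by move=> u; apply: dsumP => i /=; rewrite scale1r. Qed.
Fact dsscaleDr : right_distributive dsscale +%R.
Proof. by move=> a u v; apply: dsumP => i /=; rewrite scalerDr. Qed.
Fact dsscaleDl u : {morph dsscale^~ u : a b / a + b}.
Proof. by move=> a b; apply: dsumP => i /=; rewrite scalerDl. Qed.
HB.instance Definition _ :=
  GRing.Zmodule_isLmodule.Build K (dsum V) dsscaleA dsscale1 dsscaleDr dsscaleDl.

Lemma dsumD u v i : (u + v) i = u i + v i. Proof. by []. Qed.
Lemma dsumZ a u i : (a *: u) i = a *: u i. Proof. by []. Qed.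
Lemma dsum0 i : (0 : dsum V) i = 0. Proof. by []. Qed.

Lemma dsinj_subproof i (x : V i) :
  finite_set [set j | eqtype.dfwith (fun k => 0 : V k) x j != 0].
Proof.
apply: sub_finite_set (finite_set1 i) => j /= jN0; apply/eqP/negPn/negP => ji.
by move: jN0; rewrite eqtype.dfwith_out ?eqxx // eq_sym.
Qed.

Definition dsinj i (x : V i) : dsum V := Dsum (dsinj_subproof x).
Arguments dsinj : simpl never.

Lemma dsinjE i (x : V i) : dsinj x i = x.
Proof. exact: eqtype.dfwith_in. Qed.
Lemma dsinjNE i j (x : V i) : i != j -> dsinj x j = 0.
Proof. exact: eqtype.dfwith_out. Qed.

Fact dsinj_is_linear i : linear (@dsinj i).
Proof.
move=> a x y; apply: dsumP => j.
rewrite dsumD dsumZ; have [<-|ij] := eqVneq i j; first by rewrite !dsinjE.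
by rewrite !dsinjNE // scaler0 addr0.
Qed.
HB.instance Definition _ i :=
  GRing.isLinear.Build K (V i) (dsum V) *:%R (@dsinj i) (@dsinj_is_linear i).

Lemma dsum_fsbigE (M : nmodType) u (F : forall i, V i -> M) (r : seq I) :
  (forall i, F i 0 = 0) -> uniq r -> (forall i, u i != 0 -> i \in r) ->
  \sum_(i \in [set: I]) F i (u i) = \sum_(i <- r) F i (u i).
Proof.
move=> F0 ru ur; rewrite (fsbigE r) //.
  by apply: eq_bigl => i; rewrite in_setT.
move=> i _ /negP ir; apply/eqP/negPn/negP => Fi; apply/ir/ur.
by apply: contra_neq Fi => ->; rewrite F0.
Qed.

Lemma dsum_supp u : exists2 r : seq I, uniq r & forall i, u i != 0 -> i \in r.
Proof.
exists (finmap.enum_fset (fset_set [set i | u i != 0])); first exact: finmap.fset_uniq.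
by move=> i ui; rewrite in_fset_set ?inE //; apply: dsfunP.
Qed.

Lemma dsum_supp2 u v : exists r : seq I, [/\ uniq r,
  forall i, u i != 0 -> i \in r & forall i, v i != 0 -> i \in r].
Proof.
have [r1 _ h1] := dsum_supp u; have [r2 _ h2] := dsum_supp v.
exists (undup (r1 ++ r2)); split; first exact: undup_uniq.
  by move=> i /h1 ir; rewrite mem_undup mem_cat ir.
by move=> i /h2 ir; rewrite mem_undup mem_cat ir orbT.
Qed.

Lemma dsumE u r : uniq r -> (forall i, u i != 0 -> i \in r) ->
  u = \sum_(i <- r) dsinj (u i).
Proof.
move=> ru ur; apply: dsumP => j.
have -> : (\sum_(i <- r) dsinj (u i)) j = \sum_(i <- r) dsinj (u i) j.
  by elim/big_rec2: _ => // i _ v _ <-.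
have [jr|jr] := boolP (j \in r).
  rewrite (bigD1_seq j) // dsinjE big1 => [|i ij]; first by rewrite /= addr0.
  by rewrite dsinjNE.
rewrite big1_seq => [|i /andP[_ ir]]; last first.
  by rewrite dsinjNE //; apply: contraNneq jr => <-.
by apply/eqP; apply: contraNT jr => /ur.
Qed.

Section Lift.
Variables (W : lmodType K) (f : forall i, {linear V i -> W}).

Definition dslift u : W := \sum_(i \in [set: I]) f i (u i).

Fact dslift_is_linear : linear dslift.
Proof.
move=> a u v; have [r [ru ur vr]] := dsum_supp2 u v; rewrite /dslift.
rewrite !(@dsum_fsbigE _ _ (fun i => f i) r) //; try by move=> i; rewrite linear0.
  rewrite scaler_sumr -big_split; apply: eq_bigr => i _.
  by rewrite dsumD dsumZ linearP.
move=> i; apply: contraR => ir; rewrite dsumD dsumZ.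
have -> : u i = 0 by apply/eqP; apply: contraNT ir => /ur.
have -> : v i = 0 by apply/eqP; apply: contraNT ir => /vr.
by rewrite scaler0 addr0.
Qed.
HB.instance Definition _ :=
  GRing.isLinear.Build K (dsum V) W *:%R dslift dslift_is_linear.

Lemma dslift_inj i (x : V i) : dslift (dsinj x) = f i x.
Proof.
rewrite /dslift (@dsum_fsbigE _ _ (fun i => f i) [:: i]) //.
- by rewrite big_seq1 dsinjE.
- by move=> j; rewrite linear0.
- by move=> j; rewrite inE; apply: contraR => ji; rewrite dsinjNE // eq_sym.
Qed.

End Lift.

Lemma dsum_ext (W : lmodType K) (f g : {linear dsum V -> W}) :
  (forall i (x : V i), f (dsinj x) = g (dsinj x)) -> f =1 g.
Proof.
move=> fg u; have [r ru ur] := dsum_supp u.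
by rewrite (dsumE ru ur) !linear_sum; apply: eq_bigr.
Qed.

End DirectSum.

Arguments dsinj {K I V} i x : simpl never.

Section Span.
Variables (K : nzRingType) (V : lmodType K) (A : set V).

Lemma lspan_submodule : submodule (lspan A).
Proof.
split=> [|a u v Au Av]; first by move=> S [[S0 _] _].
by move=> S SA; have [[_ SP] _] := SA; apply: SP; [apply: Au | apply: Av].
Qed.

Lemma sub_lspan : A `<=` lspan A.
Proof. exact: sub_gen_smallest. Qed.

Lemma lspan_sub (S : set V) : submodule S -> A `<=` S -> lspan A `<=` S.
Proof. exact: smallest_sub. Qed.

Lemma lspan0 : lspan A 0. Proof. by case: lspan_submodule. Qed.
Lemma lspanP a u v : lspan A u -> lspan A v -> lspan A (a *: u + v).
Proof. by case: lspan_submodule => _; apply. Qed.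
Lemma lspanD u v : lspan A u -> lspan A v -> lspan A (u + v).
Proof. by move=> Au Av; rewrite -[u]scale1r; apply: lspanP. Qed.
Lemma lspanZ a u : lspan A u -> lspan A (a *: u).
Proof. by move=> Au; rewrite -[_ *: _]addr0; apply: lspanP => //; apply: lspan0. Qed.
Lemma lspanN u : lspan A u -> lspan A (- u).
Proof. by rewrite -scaleN1r; apply: lspanZ. Qed.

End Span.

Section Quotient.
Variables (K : nzRingType) (V : lmodType K) (A : set V).

Definition lquot_rel (u v : V) : bool := `[< lspan A (u - v) >].

Fact lquot_rel_equiv : equiv_class_of lquot_rel.
Proof.
split=> [u|u v|v u w].
- by apply/asboolP; rewrite subrr; apply: lspan0.
- by apply/asboolP/asboolP => /lspanN; rewrite opprB.
- move=> /asboolP uv /asboolP vw; apply/asboolP.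
  by rewrite -[u](subrK v) -addrA; apply: lspanD.
Qed.
Canonical lquot_equiv := EquivRelPack lquot_rel_equiv.

(* A need not be a subspace: the quotient is by its span. *)
Definition lquot := {eq_quot lquot_equiv}.
HB.instance Definition _ := Choice.on lquot.
HB.instance Definition _ := EqQuotient.on lquot.

Definition lproj (u : V) : lquot := \pi_lquot u.

Lemma lproj_eq u v : lspan A (u - v) -> lproj u = lproj v.
Proof. by move=> uv; apply/(eqquotP lquot)/asboolP. Qed.

Lemma lproj_repr (x : lquot) : lproj (repr x) = x.
Proof. exact: reprK. Qed.

Lemma repr_lproj u : lspan A (repr (lproj u) - u).
Proof. by apply/asboolP/(eqquotP lquot); rewrite reprK. Qed.

Definition lq0 : lquot := lproj 0.
Definition lqopp (x : lquot) : lquot := lproj (- repr x).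
Definition lqadd (x y : lquot) : lquot := lproj (repr x + repr y).
Definition lqscale a (x : lquot) : lquot := lproj (a *: repr x).

Lemma lqoppE u : lqopp (lproj u) = lproj (- u).
Proof.
by apply: lproj_eq; rewrite -opprD; apply: lspanN; apply: repr_lproj.
Qed.
Lemma lqaddE u v : lqadd (lproj u) (lproj v) = lproj (u + v).
Proof.
apply: lproj_eq; rewrite opprD addrACA.
by apply: lspanD; apply: repr_lproj.
Qed.
Lemma lqscaleE a u : lqscale a (lproj u) = lproj (a *: u).
Proof. by apply: lproj_eq; rewrite -scalerBr; apply: lspanZ; apply: repr_lproj. Qed.

Lemma lquotW (P : lquot -> Prop) : (forall u, P (lproj u)) -> forall x, P x.
Proof. by move=> Pu x; rewrite -(lproj_repr x). Qed.

Fact lqaddA : associative lqadd.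
Proof. by do 3![elim/lquotW => ?]; rewrite !lqaddE addrA. Qed.
Fact lqaddC : commutative lqadd.
Proof. by do 2![elim/lquotW => ?]; rewrite !lqaddE addrC. Qed.
Fact lqadd0 : left_id lq0 lqadd.
Proof. by elim/lquotW => ?; rewrite !lqaddE add0r. Qed.
Fact lqaddN : left_inverse lq0 lqopp lqadd.
Proof. by elim/lquotW => ?; rewrite lqoppE !lqaddE addNr. Qed.
HB.instance Definition _ :=
  GRing.isZmodule.Build lquot lqaddA lqaddC lqadd0 lqaddN.

Fact lqscaleA a b x : lqscale a (lqscale b x) = lqscale (a * b) x.
Proof. by elim/lquotW: x => x; rewrite !lqscaleE scalerA. Qed.
Fact lqscale1 : left_id 1 lqscale.
Proof. by elim/lquotW => x; rewrite !lqscaleE scale1r. Qed.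
Fact lqscaleDr : right_distributive lqscale +%R.
Proof.
move=> a x y; elim/lquotW: x => x; elim/lquotW: y => y.
by rewrite -[RHS]/(lqadd _ _) -[lproj x + _]/(lqadd _ _) lqaddE !lqscaleE lqaddE scalerDr.
Qed.
Fact lqscaleDl x : {morph lqscale^~ x : a b / a + b}.
Proof.
by move=> a b; elim/lquotW: x => x; rewrite -[RHS]/(lqadd _ _) !lqscaleE lqaddE scalerDl.
Qed.
HB.instance Definition _ :=
  GRing.Zmodule_isLmodule.Build K lquot lqscaleA lqscale1 lqscaleDr lqscaleDl.

Fact lproj_is_linear : linear lproj.
Proof. move=> a u v; by rewrite -lqaddE -lqscaleE. Qed.
HB.instance Definition _ :=
  GRing.isLinear.Build K V lquot *:%R lproj lproj_is_linear.

Section Lift.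
Variables (W : lmodType K) (f : {linear V -> W}).
Hypothesis fA : forall u, A u -> f u = 0.

Lemma lspan_ker u : lspan A u -> f u = 0.
Proof.
move: u; apply: lspan_sub => //; split=> [|a u v /= fu fv]; first exact: linear0.
by rewrite linearP fu fv scaler0 addr0.
Qed.

Definition lqlift (x : lquot) : W := f (repr x).

Lemma lqlift_proj u : lqlift (lproj u) = f u.
Proof. by apply/eqP; rewrite -subr_eq0 -linearB lspan_ker //; apply: repr_lproj. Qed.

Fact lqlift_is_linear : linear lqlift.
Proof.
move=> a; elim/lquotW => u; elim/lquotW => v.
by rewrite -linearP !lqlift_proj linearP.
Qed.

End Lift.
End Quotient.

(* The algebraic tensor product is the free module on V * W modulo the
   relations expressing bilinearity. *)

Section Tensor.
Variables (K : comNzRingType) (V W : lmodType K).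

Definition free_mod := dsum (fun _ : (V * W)%type => K^o : lmodType K).
HB.instance Definition _ := GRing.Lmodule.on free_mod.

Definition free_gen (x : V) (y : W) : free_mod :=
  dsinj (x, y) (1 : K^o).

Definition tens_rel : set free_mod := [set u |
  (exists a x x' y, u = free_gen (a *: x + x') y
                          - (a *: free_gen x y + free_gen x' y)) \/
  (exists a x y y', u = free_gen x (a *: y + y')
                          - (a *: free_gen x y + free_gen x y'))].

Definition tens := lquot tens_rel.
HB.instance Definition _ := GRing.Lmodule.on tens.

End Tensor.

HB.lock Definition pure (K : comNzRingType) (V W : lmodType K) (x : V) (y : W) :
  tens V W := lproj (@tens_rel K V W) (free_gen x y).
Arguments pure {K V W} x y.

Section TensorTheory.
Variables (K : comNzRingType) (V W : lmodType K).
Local Notation tens := (tens V W).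
Local Notation tens_rel := (@tens_rel K V W).
Local Notation free_mod := (free_mod V W).
Local Notation pure := (@pure K V W).

Fact pure_is_bilinear : bilinear_for *:%R *:%R pure.
Proof.
split=> [y a x x'|x a y y'].
  rewrite /applyr /= pure.unlock -linearP; apply: lproj_eq.
  apply: sub_lspan; left.
  by exists a, x, x', y.
rewrite pure.unlock -linearP; apply: lproj_eq.
apply: sub_lspan; right.
by exists a, x, y, y'.
Qed.
HB.instance Definition _ :=
  bilinear_isBilinear.Build K V W tens *:%R *:%R pure pure_is_bilinear.

Lemma tens_ind (P : tens -> Prop) :
  P 0 -> (forall x y t, P t -> P (pure x y + t)) -> forall t, P t.
Proof.
move=> P0 Pp; elim/lquotW => u.
have [r ru ur] := dsum_supp u; rewrite (dsumE ru ur) linear_sum.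
elim/big_rec: _ => // -[x y] t _ Pt /=.
rewrite (_ : lproj _ _ = pure (u (x, y) *: x) y) /=; first exact: Pp.
have -> : dsinj (x, y) (u (x, y)) = u (x, y) *: free_gen x y.
  rewrite /free_gen -(linearZ_LR (@dsinj _ _ _ (x, y))).
  by congr dsinj; rewrite /GRing.scale /= mulr1.
by rewrite linearZ_LR linearZl_LR /= pure.unlock.
Qed.

Lemma tens_sum (t : tens) :
  exists r : seq (V * W), t = \sum_(p <- r) pure p.1 p.2.
Proof.
elim/tens_ind: t => [|x y _ [r ->]]; first by exists [::]; rewrite big_nil.
by exists ((x, y) :: r); rewrite big_cons.
Qed.

Lemma tens_ext (U : lmodType K) (f g : {linear tens -> U}) :
  (forall x y, f (pure x y) = g (pure x y)) -> f =1 g.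
Proof.
move=> fg; elim/tens_ind => [|x y t IH]; first by rewrite !linear0.
by rewrite !linearD fg IH.
Qed.

Section Lift.
Variables (U : lmodType K) (f : {bilinear V -> W -> U}).

Fact free_lift_subproof (p : V * W) : linear (fun c : K^o => c *: f p.1 p.2).
Proof. by move=> a c d; rewrite scalerDl scalerA. Qed.

Definition free_lift : free_mod -> U :=
  dslift (fun p : V * W => mk_linear (free_lift_subproof p)).
HB.instance Definition _ := GRing.Linear.on free_lift.

Lemma free_lift_gen x y : free_lift (free_gen x y) = f x y.
Proof. by rewrite /free_lift dslift_inj /= scale1r. Qed.

Lemma free_lift_rel u : tens_rel u -> free_lift u = 0.
Proof.
case=> -[a [x [x' [y ->]]]];
  rewrite linearB linearP /= !free_lift_gen.
  by rewrite linearPl subrr.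
by rewrite linearPr subrr.
Qed.

End Lift.
End TensorTheory.

HB.lock Definition tens_lift (K : comNzRingType) (V W U : lmodType K)
    (f : {bilinear V -> W -> U}) : tens V W -> U :=
  lqlift (free_lift f).

Section TensorLift.
Variables (K : comNzRingType) (V W U : lmodType K) (f : {bilinear V -> W -> U}).

Fact tens_lift_is_linear : linear (tens_lift f).
Proof. by rewrite tens_lift.unlock; apply/lqlift_is_linear/free_lift_rel. Qed.
HB.instance Definition _ :=
  GRing.isLinear.Build K (tens V W) U *:%R (tens_lift f) tens_lift_is_linear.

Lemma tens_lift_pure x y : tens_lift f (pure x y) = f x y.
Proof.
rewrite tens_lift.unlock pure.unlock (lqlift_proj (@free_lift_rel _ _ _ _ f)) /=.
by rewrite free_lift_gen.
Qed.

End TensorLift.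

Section MkDot.
Variables (C : numClosedFieldType) (V : lmodType C) (f : V -> V -> C).
Hypothesis f_linear : forall w, scalar (f^~ w).
Hypothesis f_sym : forall u v, f u v = (f v u)^*.
Hypothesis f_pos : forall u, u != 0 -> 0 < f u u.

Fact mk_dot_bilinear :
  bilinear_for *%R (Num.conj \; *%R) (f : V -> V -> C).
Proof.
split=> [w a u v|u a v w] /=; first by rewrite /applyr f_linear.
by rewrite f_sym f_linear rmorphD rmorphM /= -!f_sym.
Qed.

Fact mk_dot_sym u v : f u v = (-1) ^+ false * (f v u)^*.
Proof. by rewrite mul1r -f_sym. Qed.

Definition mk_dot : {dot V for Num.conj} :=
  HB.pack f
    (bilinear_isBilinear.Build C V V C *%R
       (Num.conj \; *%R) f mk_dot_bilinear)
    (isHermitianSesquilinear.Build C V false Num.conj f mk_dot_sym)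
    (isDotProduct.Build C V f f_pos).

End MkDot.

(* All spaces below are over an abstract numClosedFieldType C; it is meant to be
   instantiated with the complex numbers R[i] over a realType R. *)
Record preHilbert (C : numClosedFieldType) := PreHilbert {
  ph_space :> lmodType C;
  ph_dot : {dot ph_space for Num.conj} }.

(* Linear in u and antilinear in v *)
Notation "''[' u , v ]" := (ph_dot _ u%R v%R) : ring_scope.

Section Conj.
Variable C : numClosedFieldType.
Implicit Types x y : C.
Lemma conjD x y : (x + y)^* = x^* + y^*. Proof. exact: rmorphD. Qed.
Lemma conjM x y : (x * y)^* = x^* * y^*. Proof. exact: rmorphM. Qed.
End Conj.

Section DotTheory.
Variables (C : numClosedFieldType) (V : preHilbert C).
Implicit Types u v w : V.

Lemma dotC u v : '[u, v] = '[v, u]^*.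
Proof. by rewrite (hermitian_subproof u v) mul1r. Qed.
Lemma dotDl u v w : '[u + v, w] = '[u, w] + '[v, w].
Proof. exact: linearDl. Qed.
Lemma dotDr u v w : '[u, v + w] = '[u, v] + '[u, w].
Proof. exact: linearDr. Qed.
Lemma dotZl a u v : '[a *: u, v] = a * '[u, v].
Proof. exact: linearZl_LR. Qed.
Lemma dotZr a u v : '[u, a *: v] = a^* * '[u, v].
Proof. exact: linearZr_LR. Qed.
Lemma dot0l u : '[0, u] = 0. Proof. exact: linear0l. Qed.
Lemma dot0r u : '[u, 0] = 0. Proof. exact: linear0r. Qed.
Lemma dotBl u v w : '[u - v, w] = '[u, w] - '[v, w].
Proof. exact: linearBl. Qed.
Lemma dot_suml I (r : seq I) (P : pred I) (F : I -> V) v :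
  '[\sum_(i <- r | P i) F i, v] = \sum_(i <- r | P i) '[F i, v].
Proof. exact: linear_sumlz. Qed.
Lemma dot_sumr I (r : seq I) (P : pred I) (F : I -> V) v :
  '[v, \sum_(i <- r | P i) F i] = \sum_(i <- r | P i) '[v, F i].
Proof. exact: linear_sumr. Qed.
Lemma dot_ge0 u : 0 <= '[u, u]. Proof. exact: dnorm_ge0. Qed.
Lemma dot_eq0 u : ('[u, u] == 0) = (u == 0). Proof. exact: dnorm_eq0. Qed.
Lemma dot_gt0 u : u != 0 -> 0 < '[u, u]. Proof. exact: neq0_dnorm_gt0. Qed.

End DotTheory.

Section Scalar.
Variable C : numClosedFieldType.
Let f (x y : C^o) : C := x * y^*.

Fact sdot_linear w : scalar (f^~ w).
Proof. by move=> a u v; rewrite /f mulrDl -mulrA. Qed.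
Fact sdot_sym u v : f u v = (f v u)^*.
Proof. by rewrite /f conjM conjCK mulrC. Qed.
Fact sdot_pos u : u != 0 -> 0 < f u u.
Proof. by move=> u0; rewrite /f mul_conjC_gt0. Qed.

Definition scalarH : preHilbert C :=
  PreHilbert (mk_dot sdot_linear sdot_sym sdot_pos).

Lemma scalarH_dotE (x y : scalarH) : '[x, y] = (x : C) * (y : C)^*.
Proof. by []. Qed.

End Scalar.

Section DsumH.
Variables (C : numClosedFieldType) (I : choiceType) (V : I -> preHilbert C).
Let f (u v : dsum V) : C := \sum_(i \in [set: I]) '[u i, v i].

Lemma dsum_dotE (u v : dsum V) (r : seq I) :
  uniq r -> (forall i, u i != 0 -> i \in r) ->
  f u v = \sum_(i <- r) '[u i, v i].
Proof.
move=> ru ur; apply: (dsum_fsbigE (F := fun i x => '[x, v i])) => // i.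
exact: dot0l.
Qed.

Fact dsum_dot_linear w : scalar (f^~ w).
Proof.
move=> a u v; have [r [ru ur vr]] := dsum_supp2 u v.
rewrite !(@dsum_dotE _ _ r) // ?mulr_sumr -?big_split; last first.
  move=> i; apply: contraR => ir; rewrite dsumD dsumZ.
  have -> : u i = 0 by apply/eqP; apply: contraNT ir => /ur.
  have -> : v i = 0 by apply/eqP; apply: contraNT ir => /vr.
  by rewrite scaler0 addr0.
by apply: eq_bigr => i _ /=; rewrite dotDl dotZl.
Qed.

Fact dsum_dot_sym u v : f u v = (f v u)^*.
Proof.
have [r [ru ur vr]] := dsum_supp2 u v.
rewrite !(@dsum_dotE _ _ r) // rmorph_sum.
by apply: eq_bigr => i _; rewrite dotC.
Qed.

Fact dsum_dot_pos u : u != 0 -> 0 < f u u.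
Proof.
have [r ru ur] := dsum_supp u; rewrite (dsum_dotE _ ru ur) => u0.
rewrite lt_def sumr_ge0 ?andbT => [|i _]; last exact: dot_ge0.
apply: contra_neq u0 => /eqP.
rewrite psumr_eq0 => [/allP u0|i _]; last exact: dot_ge0.
apply: dsumP => i; have [ir|ir] := boolP (i \in r).
  by apply/eqP; rewrite -dot_eq0; apply: u0.
by apply/eqP; apply: contraNT ir => /ur.
Qed.

Definition dsumH : preHilbert C :=
  PreHilbert (mk_dot dsum_dot_linear dsum_dot_sym dsum_dot_pos).

Lemma dsumH_dotE (u v : dsumH) :
  '[u, v] = \sum_(i \in [set: I]) '[(u : dsum V) i, (v : dsum V) i].
Proof. by []. Qed.

Lemma dsumH_dot_inj i (x y : V i) :
  '[dsinj i x : dsumH, dsinj i y : dsumH] = '[x, y].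
Proof.
rewrite [LHS](@dsum_dotE _ _ [:: i]) ?big_seq1 ?dsinjE // => j.
by rewrite inE; apply: contraR => ji; rewrite dsinjNE // eq_sym.
Qed.

Lemma dsumH_dot_injN i j (x : V i) (y : V j) :
  i != j -> '[dsinj i x : dsumH, dsinj j y : dsumH] = 0.
Proof.
move=> ij; rewrite [LHS](@dsum_dotE _ _ [:: i]) ?big_seq1 //.
  by rewrite (dsinjNE y) ?dot0r // eq_sym.
by move=> k; rewrite inE; apply: contraR => ki; rewrite dsinjNE // eq_sym.
Qed.

End DsumH.

Section TensH.
Variables (C : numClosedFieldType) (V W : preHilbert C).

Fact tens_dot_inner_bilinear (x : V) (y : W) :
  bilinear_for *:%R *:%R (fun x' y' => '[x', x] * '[y', y] : C^o).
Proof.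
split=> [y' a x1 x2|x' a y1 y2] /=.
  by rewrite /applyr dotDl dotZl mulrDl -mulrA.
by rewrite dotDl dotZl mulrDr mulrCA.
Qed.

Definition tens_dot_inner x y : tens V W -> C :=
  tens_lift (mk_bilinear (tens_dot_inner_bilinear x y)).

Lemma tens_dot_innerD x y t t' :
  tens_dot_inner x y (t + t') = tens_dot_inner x y t + tens_dot_inner x y t'.
Proof. exact: linearD. Qed.
Lemma tens_dot_inner0 x y : tens_dot_inner x y 0 = 0.
Proof. exact: linear0. Qed.
Lemma tens_dot_innerE x y x' y' :
  tens_dot_inner x y (pure x' y') = '[x', x] * '[y', y].
Proof. exact: tens_lift_pure. Qed.

Fact tens_dot_outer_bilinear (t' : tens V W) :
  bilinear_for *:%R *:%R (fun x y => (tens_dot_inner x y t')^* : C^o).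
Proof.
split=> [y a x1 x2|x a y1 y2] /=; rewrite /applyr.
  elim/tens_ind: t' => [|x' y' t' IH].
    by rewrite !tens_dot_inner0 !conjC0 scaler0 addr0.
  rewrite !tens_dot_innerD !conjD IH.
  rewrite !tens_dot_innerE !conjM -!dotC.
  by rewrite dotDl dotZl mulrDl -mulrA scalerDr addrACA.
elim/tens_ind: t' => [|x' y' t' IH].
  by rewrite !tens_dot_inner0 !conjC0 scaler0 addr0.
rewrite !tens_dot_innerD !conjD IH !tens_dot_innerE !conjM -!dotC.
by rewrite dotDl dotZl mulrDr mulrCA scalerDr addrACA.
Qed.

Definition tens_dot (t t' : tens V W) : C :=
  tens_lift (mk_bilinear (tens_dot_outer_bilinear t')) t.

Lemma tens_dot_pure x y x' y' :
  tens_dot (pure x y) (pure x' y') = '[x, x'] * '[y, y'].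
Proof.
by rewrite /tens_dot tens_lift_pure /= tens_dot_innerE conjM -!dotC.
Qed.

Fact tens_dot_linear w : scalar (tens_dot^~ w).
Proof. by move=> a u v; rewrite /tens_dot linearP. Qed.

Lemma tens_dotDl u v w : tens_dot (u + v) w = tens_dot u w + tens_dot v w.
Proof. by rewrite /tens_dot linearD. Qed.
Lemma tens_dot0l w : tens_dot 0 w = 0.
Proof. by rewrite /tens_dot linear0. Qed.

Lemma tens_dotDr u v w : tens_dot w (u + v) = tens_dot w u + tens_dot w v.
Proof.
elim/tens_ind: w => [|x y t IH]; first by rewrite !tens_dot0l addr0.
rewrite !tens_dotDl IH addrACA; congr (_ + _).
by rewrite /tens_dot !tens_lift_pure /= tens_dot_innerD conjD.
Qed.
Lemma tens_dot0r w : tens_dot w 0 = 0.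
Proof.
elim/tens_ind: w => [|x y t IH]; first by rewrite tens_dot0l.
rewrite tens_dotDl IH addr0 /tens_dot tens_lift_pure /=.
by rewrite tens_dot_inner0 conjC0.
Qed.

Fact tens_dot_sym u v : tens_dot u v = (tens_dot v u)^*.
Proof.
elim/tens_ind: u => [|x y t IH]; first by rewrite tens_dot0l tens_dot0r conjC0.
rewrite tens_dotDl tens_dotDr conjD IH; congr (_ + _).
elim/tens_ind: v {IH} => [|x' y' v IH].
  by rewrite tens_dot0l tens_dot0r conjC0.
rewrite tens_dotDl tens_dotDr conjD IH; congr (_ + _).
by rewrite !tens_dot_pure conjM -!dotC.
Qed.

Lemma tens_dot_suml n (F : 'I_n -> tens V W) v :
  tens_dot (\sum_(i < n) F i) v = \sum_(i < n) tens_dot (F i) v.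
Proof.
by elim/big_rec2: _ => [|i a b _ <-]; rewrite ?tens_dot0l ?tens_dotDl.
Qed.
Lemma tens_dot_sumr n (F : 'I_n -> tens V W) v :
  tens_dot v (\sum_(i < n) F i) = \sum_(i < n) tens_dot v (F i).
Proof.
by elim/big_rec2: _ => [|i a b _ <-]; rewrite ?tens_dot0r ?tens_dotDr.
Qed.

(* Gram-Schmidt in the first factor *)
Lemma tens_orth (t : tens V W) : exists n (e : nat -> V) (w : nat -> W),
  (forall i j, (i < n)%N -> (j < n)%N -> i != j -> '[e i, e j] = 0) /\
  t = \sum_(i < n) pure (e i) (w i).
Proof.
elim/tens_ind: t => [|x y _ [n [e [w [eo ->]]]]].
  by exists 0%N, (fun=> 0), (fun=> 0); split=> //; rewrite big_ord0.
pose c i := '[x, e i] / '[e i, e i].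
pose x' := x - \sum_(i < n) c i *: e i.
have x'o j : (j < n)%N -> '[x', e j] = 0.
  move=> jn; rewrite /x' dotBl dot_suml (bigD1 (Ordinal jn)) //= big1 => [|i ij].
    rewrite addr0 dotZl /c; have [->|ej] := eqVneq (e j) 0.
      by rewrite !dot0r mulr0 subrr.
    by rewrite divfK ?subrr // dot_eq0.
  by rewrite dotZl eo ?mulr0 //; apply: contraNneq ij => ij; apply/eqP/val_inj.
exists n.+1, (fun i => if i == n then x' else e i),
  (fun i => if i == n then y else w i + c i *: y); split.
  move=> i j; rewrite !ltnS => iN jN ij.
  case: eqVneq => [ii|iN']; case: eqVneq => [jj|jN'].
  - by rewrite ii jj eqxx in ij.
  - by rewrite x'o // ltn_neqAle jN'.
  - by rewrite dotC x'o ?conjC0 // ltn_neqAle iN'.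
  - by rewrite eo // ltn_neqAle ?iN' ?jN'.
rewrite big_ord_recr /= eqxx.
rewrite [in RHS](eq_bigr (fun i : 'I_n => pure (e i) (w i) + c i *: pure (e i) y)); last first.
  by move=> i _ /=; rewrite (ltn_eqF (ltn_ord i)) linearDr linearZr_LR.
rewrite big_split /= -addrA [LHS]addrC; congr (_ + _).
rewrite -{1}[x](subrK (\sum_(i < n) c i *: e i)) -/x'.
rewrite linearDl addrC; congr (_ + _).
by rewrite linear_sumlz; apply: eq_bigr => i _; rewrite linearZl_LR.
Qed.

Fact tens_dot_pos u : u != 0 -> 0 < tens_dot u u.
Proof.
have [n [e [w [eo ->]]]] := tens_orth u => u0.
have -> : tens_dot (\sum_(i < n) pure (e i) (w i))
                   (\sum_(i < n) pure (e i) (w i))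
        = \sum_(i < n) '[e i, e i] * '[w i, w i].
  rewrite tens_dot_suml; apply: eq_bigr => i _.
  rewrite tens_dot_sumr (bigD1 i) //= big1 => [|j ji].
    by rewrite tens_dot_pure addr0.
  rewrite tens_dot_pure eo ?mul0r //.
  by apply: contraNneq ji => ij; apply/eqP/esym/val_inj.
rewrite lt_def sumr_ge0 ?andbT => [|i _]; last by rewrite mulr_ge0 ?dot_ge0.
apply: contra_neq u0 => /eqP.
rewrite psumr_eq0 => [/allP w0|i _]; last by rewrite mulr_ge0 ?dot_ge0.
apply: big1 => i _; have := w0 i (mem_index_enum i).
rewrite mulf_eq0 !dot_eq0 => /orP[] /eqP ->.
  by rewrite linear0l.
by rewrite linear0r.
Qed.

Definition tensH : preHilbert C :=
  PreHilbert (mk_dot tens_dot_linear tens_dot_sym tens_dot_pos).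

Lemma tensH_dotE (x x' : V) (y y' : W) :
  '[pure x y : tensH, pure x' y' : tensH] = '[x, x'] * '[y, y'].
Proof. exact: tens_dot_pure. Qed.

End TensH.

Record hilbert (C : numClosedFieldType) := Hilbert {
  hil_space :> completeNormedModType C;
  hil_dot : {dot hil_space for Num.conj};
  hil_normE : forall x : hil_space, `|x| ^+ 2 = hil_dot x x }.

Arguments hil_dot {C} h.

(* A completion is only determined up to a unitary fixing V, hence a type of
   completions rather than a chosen one. *)
Record completion (C : numClosedFieldType) (V : preHilbert C) := Completion {
  cpl_space :> hilbert C;
  cpl_emb : {linear V -> cpl_space};
  cpl_embE : forall x y : V, hil_dot cpl_space (cpl_emb x) (cpl_emb y) = '[x, y];
  cpl_dense : dense (range cpl_emb) }.

Section Fock.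
Variables (C : numClosedFieldType) (H : preHilbert C).

Fixpoint tpow (n : nat) : preHilbert C :=
  if n is n'.+1 then tensH H (tpow n') else scalarH C.

Definition fock : preHilbert C := dsumH tpow.

Definition vacuum : fock := dsinj 0%N (1 : C^o).

(* etens x n is x_n (x) ... (x) x_1: indices start at 1 and x 0 is not used. *)
Fixpoint etens (x : nat -> H) (n : nat) : tpow n :=
  if n is n'.+1 then pure (x n) (etens x n') else (1 : C^o).

Lemma etens_dot (x y : nat -> H) n :
  '[etens x n, etens y n] = \prod_(1 <= k < n.+1) '[x k, y k].
Proof.
elim: n => [|n IH].
  by rewrite big_nil scalarH_dotE mul1r conjC1.
by rewrite [LHS]tensH_dotE IH [RHS]big_nat_recr // mulrC.
Qed.

Lemma vacuum_dot : '[vacuum, vacuum] = 1.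
Proof. by rewrite [LHS]dsumH_dot_inj scalarH_dotE mul1r conjC1. Qed.

Fact fock_cre_subproof (x : H) n :
  linear (fun t : tpow n => dsinj n.+1 (pure x t : tpow n.+1) : fock).
Proof. by move=> a s t; rewrite linearPr /= linearP. Qed.

Definition fock_cre (x : H) : fock -> fock :=
  dslift (fun n => mk_linear (@fock_cre_subproof x n)).
HB.instance Definition _ x := GRing.Linear.on (fock_cre x).

Lemma fock_cre_inj x n (t : tpow n) :
  fock_cre x (dsinj n t) = dsinj n.+1 (pure x t : tpow n.+1).
Proof. exact: dslift_inj. Qed.

End Fock.

Record ifs (C : numClosedFieldType) (H : preHilbert C) := Ifs {
  ifs_comp : nat -> preHilbert C;
  ifs_vac : ifs_comp 0;
  ifs_cre : {bilinear H -> dsumH ifs_comp -> dsumH ifs_comp};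
  ifs_vac_dot : '[ifs_vac, ifs_vac] = 1;
  ifs_vac_line : forall h : ifs_comp 0, exists c : C, h = c *: ifs_vac;
  ifs_total : forall n,
    lspan [set v | exists (x : H) (h : ifs_comp n), v = ifs_cre x (dsinj n h)]
    = range (@dsinj _ _ (fun k => ifs_comp k) n.+1) }.

Section Lambda.
Variables (C : numClosedFieldType) (H : preHilbert C) (I : ifs H).

Definition ifs_space : preHilbert C := dsumH (ifs_comp I).
Definition ifs_vacuum : ifs_space := dsinj 0%N (ifs_vac I).

Fact Lambda0_subproof : linear (fun c : C^o => c *: ifs_vacuum).
Proof. by move=> a b c; rewrite scalerDl scalerA. Qed.

Fact LambdaS_subproof n (L : {linear tpow H n -> ifs_space}) :
  bilinear_for *:%R *:%R (fun x t => ifs_cre I x (L t)).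
Proof.
by split=> [t a x y|x a s t]; rewrite /applyr ?linearPl // linearP linearPr.
Qed.

Fixpoint Lambda_comp (n : nat) : {linear tpow H n -> ifs_space} :=
  if n is n'.+1 then tens_lift (mk_bilinear (LambdaS_subproof (Lambda_comp n')))
  else mk_linear Lambda0_subproof.

Definition Lambda : fock H -> ifs_space := dslift Lambda_comp.
HB.instance Definition _ := GRing.Linear.on Lambda.

Lemma Lambda_inj n (t : tpow H n) : Lambda (dsinj n t) = Lambda_comp n t.
Proof. exact: dslift_inj. Qed.

Lemma Lambda_vacuum : Lambda (vacuum H) = ifs_vacuum.
Proof. by rewrite Lambda_inj /= scale1r. Qed.

Lemma Lambda_cre x X : Lambda (fock_cre x X) = ifs_cre I x (Lambda X).
Proof.
pose f : {linear fock H -> ifs_space} := Lambda \o fock_cre x.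
pose g : {linear fock H -> ifs_space} := ifs_cre I x \o Lambda.
suff /(_ X) : f =1 g by [].
apply: dsum_ext => n t /=.
by rewrite fock_cre_inj !Lambda_inj /= tens_lift_pure.
Qed.

(* Lambda (x_n (x) ... (x) x_1) = a^*(x_n) ... a^*(x_1) Omega *)
Lemma Lambda_etens (x : nat -> H) n :
  Lambda (dsinj n (etens x n))
  = iteri n (fun k => ifs_cre I (x k.+1)) ifs_vacuum.
Proof.
elim: n => [|n IH]; first exact: Lambda_vacuum.
by rewrite -fock_cre_inj Lambda_cre IH.
Qed.

Lemma Lambda_surj (Y : ifs_space) : exists X, Lambda X = Y.
Proof.
have subR : submodule (range Lambda).
  split=> [|a u v [X _ <-] [Z _ <-]]; first by exists 0; rewrite ?linear0.
  by exists (a *: X + Z); rewrite ?linearP.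
have inR n (h : ifs_comp I n) : range Lambda (dsinj n h).
  elim: n h => [|n IH] h.
    have [c ->] := ifs_vac_line h; exists (c *: vacuum H) => //.
    by rewrite linearZ_LR /= Lambda_vacuum [RHS]linearZ_LR.
  have : range (@dsinj _ _ (fun k => ifs_comp I k) n.+1) (dsinj n.+1 h).
    by exists h.
  rewrite -ifs_total; apply: (lspan_sub subR) => _ [x [k ->]].
  by have [X _ <-] := IH k; exists (fock_cre x X); rewrite ?Lambda_cre.
have [r ru ur] := dsum_supp Y; rewrite (dsumE ru ur).
have [X _ <-] : range Lambda (\sum_(i <- r) dsinj i (Y i)); last by exists X.
elim: r {ru ur} => [|i r IH]; first by rewrite big_nil; case: subR.
rewrite big_cons -[X in range _ (X + _)]scale1r.
by case: subR => _; apply.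
Qed.

Lemma Lambda_graded n (t : tpow H n) :
  exists h : ifs_comp I n, Lambda (dsinj n t) = dsinj n h.
Proof.
rewrite Lambda_inj; elim: n t => [|n IH] t /=.
  by exists (t *: ifs_vac I); rewrite linearZ_LR.
elim/tens_ind: t => [|x s t [h th]].
  by exists 0; rewrite !linear0.
have [h' sh'] := IH s.
have : lspan [set v | exists x h, v = ifs_cre I x (dsinj n h)]
   (ifs_cre I x (Lambda_comp n s)).
  by apply: sub_lspan; exists x, h'; rewrite sh'.
rewrite ifs_total => -[h'' _ E].
by exists (h'' + h); rewrite !linearD /= tens_lift_pure th /= -E.
Qed.

End Lambda.

(* ALV-interacting Fock spaces. The space itself is the quotient of fock H by
   the kernel of alv_form; all of its structure is induced by alv_form. *)

Record alv (C : numClosedFieldType) (H : preHilbert C) := Alv {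
  alv_form : {hermitian fock H for false & Num.conj};
  alv_ge0 : forall X : fock H, 0 <= alv_form X X;
  alv_graded : forall m n (X : tpow H m) (Y : tpow H n),
    m != n -> alv_form (dsinj m X) (dsinj n Y) = 0;
  alv_vacuum : alv_form (vacuum H) (vacuum H) = 1;
  alv_cre : forall (x : H) (X : fock H), alv_form X X = 0 ->
    alv_form (fock_cre x X) (fock_cre x X) = 0 }.

Section AlvOfIfs.
Variables (C : numClosedFieldType) (H : preHilbert C) (I : ifs H).

Let f (X Y : fock H) : C := '[Lambda I X, Lambda I Y].

Fact alv_of_ifs_bilinear : bilinear_for *%R (Num.conj \; *%R) f.
Proof.
split=> [Y a X X'|X a Y Y'] /=.
  by rewrite /applyr /f linearP dotDl dotZl.
by rewrite /f linearP dotDr dotZr.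
Qed.

Fact alv_of_ifs_sym X Y : f X Y = (-1) ^+ false * (f Y X)^*.
Proof. by rewrite mul1r; apply: dotC. Qed.

Definition alv_of_ifs_form : {hermitian fock H for false & Num.conj} :=
  HB.pack f
    (bilinear_isBilinear.Build C (fock H) (fock H) C *%R
       (Num.conj \; *%R) f alv_of_ifs_bilinear)
    (isHermitianSesquilinear.Build C (fock H) false Num.conj f alv_of_ifs_sym).

Fact alv_of_ifs_ge0 X : 0 <= alv_of_ifs_form X X.
Proof. exact: dot_ge0. Qed.

Fact alv_of_ifs_graded m n (X : tpow H m) (Y : tpow H n) :
  m != n -> alv_of_ifs_form (dsinj m X) (dsinj n Y) = 0.
Proof.
move=> mn; rewrite /= /f.
have [h ->] := Lambda_graded I X; have [k ->] := Lambda_graded I Y.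
exact: dsumH_dot_injN.
Qed.

Fact alv_of_ifs_vacuum : alv_of_ifs_form (vacuum H) (vacuum H) = 1.
Proof. by rewrite /= /f Lambda_vacuum [LHS]dsumH_dot_inj ifs_vac_dot. Qed.

Fact alv_of_ifs_cre (x : H) (X : fock H) : alv_of_ifs_form X X = 0 ->
  alv_of_ifs_form (fock_cre x X) (fock_cre x X) = 0.
Proof.
rewrite /= /f => /eqP; rewrite dot_eq0 Lambda_cre => /eqP ->.
by rewrite linear0 dot0l.
Qed.

Definition alv_of_ifs : alv H :=
  Alv alv_of_ifs_ge0 alv_of_ifs_graded alv_of_ifs_vacuum alv_of_ifs_cre.

Lemma alv_of_ifsE X Y : alv_form alv_of_ifs X Y = '[Lambda I X, Lambda I Y].
Proof. by []. Qed.

End AlvOfIfs.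

(* L is the direct sum of the L_n; the closure of the image of the n-th tensor
   power in the completion of fock H is the completion of that tensor power. *)
Definition POI (C : numClosedFieldType) (H : preHilbert C)
    (F : completion (fock H)) (A : alv H) : Prop :=
  exists L : forall n, {linear tpow H n -> F},
    [/\ forall n t, closure (range (cpl_emb F \o @dsinj _ _ (tpow H) n)) (L n t),
        L 0%N (1 : C^o) = cpl_emb F (vacuum H)
      & forall X Y : fock H,
          alv_form A X Y = hil_dot F (cpl_emb F X) (dslift L Y)].

(* Main.v *)
Require Import Defs.
From HB Require Import structures.
From mathcomp Require Import all_boot all_order all_algebra sesquilinear complex.
From mathcomp Require Import all_classical all_reals all_analysis.

Set Implicit Arguments.
Unset Strict Implicit.
Unset Printing Implicit Defensive.

Import Order.TTheory GRing.Theory Num.Theory.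
Import numFieldNormedType.Exports.
Local Open Scope classical_set_scope.
Local Open Scope ring_scope.

(** Since [Lambda] is onto, an adjoint of [Lambda] and a map [L] representing
    the form [<Lambda -, Lambda ->] determine each other by the single equation
    [L = Ladj o Lambda].

    Given [Ladj], put [L_n t = Ladj (Lambda t)].  Because [Lambda] respects the
    grading and the components of the target are mutually orthogonal, [L_n t]
    is orthogonal to every tensor power except the [n]-th.  Such a vector lies
    in the closure of the [n]-th tensor power ([closure_component]): deleting
    the foreign components of an approximating Fock vector only brings it
    closer, by Pythagoras.  Likewise [L Omega] and [Omega] have the same inner
    products with all Fock vectors, so they agree.

    Given [L], choose for each [Y] a preimage [X] under [Lambda] and set
    [Ladj Y = L X].  This satisfies the adjoint equation, and the adjoint
    equation forces linearity, because a vector of the completion is determined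
    by its inner products with the dense subspace ([cpl_dot_inj]).

    Both density arguments rest on one inequality, [hil_norm_orth_le]: adding
    an orthogonal vector does not decrease the norm. *)

(** A Hilbert space forgets to a pre-Hilbert space, which makes the calculus of
    inner products available on completions. *)
Definition hil_pre (C : numClosedFieldType) (F : hilbert C) : preHilbert C :=
  PreHilbert (hil_dot F).

Section Completion.
Variables (C : numClosedFieldType) (V : preHilbert C) (F : completion V).

(** Pythagoras: [|u + v|^2 = |u|^2 + |v|^2].  It is used with [u] in the dense
    subspace, so that density yields statements about [v] without passing to a
    limit. *)
Lemma hil_norm_orth_le (u v : F) : hil_dot F u v = 0 -> `|v| <= `|u + v|.
Proof.
move=> uv; rewrite -(@ler_pXn2r _ 2) ?nnegrE ?normr_ge0 // !hil_normE.
have vu : hil_dot F v u = 0.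
  by have := dotC (v : hil_pre F) u; rewrite /= uv conjC0.
rewrite linearDl !linearDr /= uv vu addr0 add0r lerDr.
exact: (dot_ge0 (u : hil_pre F)).
Qed.

Lemma cpl_approx (y : F) (e : C) :
  0 < e -> exists X : V, `|cpl_emb F X - y| < e.
Proof.
move=> e0; have [] := @cpl_dense _ _ F (ball y e).
- by exists y; apply: ballxx.
- exact: ball_open.
- move=> _ [/[swap] [[X _ <-]]]; rewrite -ball_normE /= distrC => Xy.
  by exists X.
Qed.

(** A vector orthogonal to the dense subspace cannot be approximated from it
    to within less than its own norm. *)
Lemma cpl_dot_inj (y z : F) :
  (forall X : V, hil_dot F (cpl_emb F X) y = hil_dot F (cpl_emb F X) z) ->
  y = z.
Proof.
move=> yz; apply/eqP; rewrite -subr_eq0 -normr_eq0; apply: contraT => n0.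
have [|X] := @cpl_approx (y - z) `|y - z|; first by rewrite lt_def n0 normr_ge0.
rewrite real_ltNge ?normr_real // -[X in X <= _]normrN hil_norm_orth_le //.
by rewrite linearNr /= linearBr /= yz subrr oppr0.
Qed.

End Completion.

(** If [X] approximates [y], so does its [n]-th component: the rest of [X] is
    orthogonal both to that component and to [y]. *)
Lemma closure_component (C : numClosedFieldType) (I : choiceType)
    (V : I -> preHilbert C) (F : completion (dsumH V)) (n : I) (y : F) :
  (forall m (x : V m), m != n -> hil_dot F (cpl_emb F (dsinj m x)) y = 0) ->
  closure (range (cpl_emb F \o @dsinj _ _ V n)) y.
Proof.
move=> yo B /nbhs_ballP[e /= e0 eB]; have [X Xy] := cpl_approx y e0.
exists (cpl_emb F (dsinj n (X n))); split; first by exists (X n).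
apply: eB; rewrite -ball_normE /= distrC; apply: le_lt_trans Xy.
set X' : dsumH V := X - dsinj n (X n).
have -> : cpl_emb F X - y = cpl_emb F X' + (cpl_emb F (dsinj n (X n)) - y).
  by rewrite /X' linearB addrA subrK.
apply: hil_norm_orth_le; have [r ru ur] := dsum_supp (X' : dsum V).
rewrite (dsumE ru ur) linear_sum linear_sumlz big1 // => i _.
have [->|ni] := eqVneq i n.
  by rewrite /X' dsumD -scaleN1r dsumZ dsinjE scaleN1r subrr !linear0 linear0l.
by rewrite linearBr /= cpl_embE dsumH_dot_injN // yo // subrr.
Qed.

Section Adjoint.
Variables (C : numClosedFieldType) (H : preHilbert C) (I : ifs H)
  (F : completion (fock H)).

Definition is_Lambda_adj (Ladj : ifs_space I -> F) : Prop :=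
  forall (X : fock H) (Y : ifs_space I),
    '[Lambda I X, Y] = hil_dot F (cpl_emb F X) (Ladj Y).

(** Any preimage-picking recipe for an adjoint is automatically linear, so the
    preimages need not be chosen linearly. *)
Lemma Lambda_adj_linear Ladj : is_Lambda_adj Ladj -> linear Ladj.
Proof.
move=> adj a Y Z; apply: cpl_dot_inj => X.
by rewrite -adj dotDr dotZr [RHS]linearDr linearZr_LR /= -!adj.
Qed.

(** Only the vacuum component of a Fock vector contributes to either side, and
    there [Lambda] is the isometry sending the vacuum to the vacuum. *)
Lemma Lambda_adj_vacuum Ladj :
  is_Lambda_adj Ladj -> Ladj (ifs_vacuum I) = cpl_emb F (vacuum H).
Proof.
move=> adj; apply: cpl_dot_inj => X; rewrite -adj cpl_embE.
have [r ru ur] := dsum_supp (X : dsum (tpow H)).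
rewrite (dsumE ru ur) linear_sum !dot_suml; apply: eq_bigr => -[|i] _.
  rewrite [X in '[X, _] = _]Lambda_inj [Lambda_comp _ _]/=.
  by rewrite dotZl !dsumH_dot_inj ifs_vac_dot scalarH_dotE conjC1.
have [h Lh] := Lambda_graded I (X i.+1).
by rewrite [X in '[X, _] = _]Lh !dsumH_dot_injN.
Qed.

Lemma Lambda_adj_POI (Ladj : {linear ifs_space I -> F}) :
  is_Lambda_adj Ladj -> POI F (alv_of_ifs I).
Proof.
move=> adj.
pose L n : {linear tpow H n -> F} := Ladj \o Lambda I \o @dsinj _ _ (tpow H) n.
have LE : dslift L =1 Ladj \o Lambda I.
  pose g : {linear fock H -> F} := Ladj \o Lambda I.
  apply: (dsum_ext (f := dslift L) (g := g)) => n t.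
  exact: dslift_inj.
exists L; split=> [n t||X Y].
- apply: closure_component => m x mn; rewrite /L /= -adj.
  have [h ->] := Lambda_graded I x; have [k ->] := Lambda_graded I t.
  exact: dsumH_dot_injN.
- rewrite -(Lambda_adj_vacuum adj) -Lambda_vacuum; exact: erefl.
- by rewrite LE alv_of_ifsE adj.
Qed.

Lemma POI_Lambda_adj :
  POI F (alv_of_ifs I) -> exists Ladj : {linear ifs_space I -> F},
    is_Lambda_adj Ladj.
Proof.
move=> [L [_ _ LP]]; have [s sK] := choice (Lambda_surj (I := I)).
have adj : is_Lambda_adj (dslift L \o s).
  by move=> X Y; rewrite /= -LP alv_of_ifsE sK.
by exists (mk_linear (Lambda_adj_linear adj)).
Qed.

End Adjoint.

Theorem corollary2p6 (R : realType) (H : preHilbert R[i]) (I : ifs H)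
    (F : completion (fock H)) :
  (exists Ladj : {linear ifs_space I -> F},
     forall (X : fock H) (Y : ifs_space I),
       '[Lambda I X, Y] = hil_dot F (cpl_emb F X) (Ladj Y))
  <-> POI F (alv_of_ifs I).
Proof.
split=> [[Ladj adj]|]; [exact: Lambda_adj_POI adj | exact: POI_Lambda_adj].
Qed.
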